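(* Consider the market with listed option prices described in the context. Let $\xi>0$ and let $p,q>1$ satisfy $\frac1p+\frac1q=1$ and $\tilde\xi p>1$, where $\tilde\xi=\frac{2\xi}{\tau}$. Let $\Pi^1_T,\Pi^2_T,\Pi^3_T$ be the time-$T$ values of the option portfolios defined in the context. If the inequality $\Pi_T^3<\Pi_T^1+\Pi_T^2$ is reversed at time $T$, that is, if $\Pi_T^3>\Pi_T^1+\Pi_T^2$, then there is an arbitrage at time $T$.
   Context: Market: $S_t>0$ is the price of an underlying asset, $r\ge0$ a constant interest rate, $B_{t,T}=e^{-r(T-t)}$ the price at $t$ of the bond paying $1$ at $T$, and $F_{t,T}=S_t/B_{t,T}$ the futures price on $S_T$. $\tau>0$ is a constant (30 days), $T>0$ is fixed. Listed at each time are prices $P(t,K,T')$ and $C(t,K,T')$ of European puts and calls on $S_{T'}$ (payoffs $(K-S_{T'})^+$, $(S_{T'}-K)^+$ at $T'$) for all strikes $K>0$, and prices $C^{vix}(t,K,T)$ of European calls on $\mathrm{VIX}_T$ (payoff $(\mathrm{VIX}_T-K)^+$ at $T$). These listed prices are not assumed to be given by risk-neutral expectations (options may be mispriced). Prices at maturity equal payoffs. Static portfolios holding a continuum of options over strikes (together with bonds, futures and the underlying) are allowed; the cost of such a portfolio is the corresponding integral of listed prices, and all integrals below are assumed finite. The VIX is computed from listed prices: $$\mathrm{VIX}_T^2=\frac{2}{\tau B_{T,T+\tau}}\left(\int_0^{F_{T,T+\tau}}P(T,K,T+\tau)\frac{dK}{K^2}+\int_{F_{T,T+\tau}}^\infty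 C(T,K,T+\tau)\frac{dK}{K^2}\right),$$ i.e. $\mathrm{VIX}_T^2$ is the future (undiscounted) value at time $T$ of the replicated claim $-\frac2\tau\log(S_{T+\tau}/F_{T,T+\tau})$ paid at $T+\tau$. Portfolios, for $t\le T$, with $\tilde\xi=2\xi/\tau$: $$\Pi_t^1=\frac{\tilde\xi(\tilde\xi q+1)}{B_{T,T+\tau}}\int_0^\infty\frac{P(t,K,T+\tau)}{K^{\tilde\xi q+2}}\,dK,\qquad \Pi_t^2=\frac{\tilde\xi(\tilde\xi p-1)}{B_{T,T+\tau}^{\tilde\xi p}}\int_0^\infty C(t,K,T)\frac{dK}{K^{2-\tilde\xi p}},$$ $$\Pi_t^3=B_{t,T}+\int_0^\infty(2\xi+4\xi^2K^2)e^{\xi K^2}C^{vix}(t,K,T)\,dK .$$ They are the time-$t$ values of the static portfolios replicating, respectively, the claim $\frac{1}{qB_{T,T+\tau}}S_{T+\tau}^{-\tilde\xi q}$ paid at $T+\tau$, the claim $\frac1p(F_{T,T+\tau})^{\tilde\xi p}$ paid at $T$, and the claim $e^{\xi\mathrm{VIX}_T^2}$ paid at $T$. Arbitrage at time $T$: a static portfolio of the traded assets, set up at time $T$ and held to $T+\tau$, whose entry cost is non-positive and whose payoff at $T+\tau$ is non-negative, with either strictly negative entry cost or positive probability of a strictly positive payoff. *)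

(* Defs.v *)
From HB Require Import structures.
From mathcomp Require Import all_boot all_order all_algebra.
From mathcomp Require Import all_classical all_reals all_analysis.
Import Order.TTheory GRing.Theory Num.Theory.
Import numFieldNormedType.Exports.

Set Implicit Arguments.
Unset Strict Implicit.
Unset Printing Implicit Defensive.

Local Open Scope classical_set_scope.
Local Open Scope ring_scope.

Definition strikes {R : realType} : set R := `]0, +oo[%classic.

Definition finite_integral {R : realType} (D : set R) (f : R -> R) : Prop :=
  (@lebesgue_measure R).-integrable D (EFin \o f).

Definition strike_integral {R : realType} (D : set R) (f : R -> R) : R :=
  (\int[@lebesgue_measure R]_(K in D) f K)%R.

Definition put_payoff {R : realType} (K x : R) : R := Num.max (K - x) 0.
Definition call_payoff {R : realType} (K x : R) : R := Num.max (x - K) 0.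

Definition bond {R : realType} (r t T : R) : R := expR (- r * (T - t)).

Definition futures {R : realType} {Omega : Type} (r : R) (S : R -> Omega -> R)
    (t T : R) (w : Omega) : R := S t w / bond r t T.

Definition xi_tilde {R : realType} (tau xi : R) : R := 2 * xi / tau.

Record filtration {d : measure_display} (Omega : measurableType d)
    (R : realType) := Filtration {
  events :> R -> set (set Omega) ;
  events_sigma_algebra : forall t, sigma_algebra setT (events t) ;
  events_measurable : forall t, events t `<=` measurable ;
  events_mono : forall s t, s <= t -> events s `<=` events t
}.

(* [Omega] equipped with the sigma-algebra of the events known at time [t]. *)
Definition known {d : measure_display} {Omega : measurableType d}
    {R : realType} (F : filtration Omega R) (t : R) :=
  g_sigma_algebraType (F t).

(* Listed prices are arbitrary adapted quantities: no pricing measure and no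
   no-arbitrage relation ties them together before maturity.
   [put_price t K T' w], [call_price t K T' w]: prices at [t] of the European
   options of strike [K] and maturity [T'];
   [vix_call_price t K w]: price at [t] of the call of strike [K] on the VIX
   at the fixed date [T].
   Listed prices may be negative, so [vix] is a nonnegative quantity whose
   square is the replication formula rather than a square root of it. *)
Record market {d : measure_display} {Omega : measurableType d} {R : realType}
    (r tau T : R) := Market {
  info : filtration Omega R ;
  spot : R -> Omega -> R ;
  put_price : R -> R -> R -> Omega -> R ;
  call_price : R -> R -> R -> Omega -> R ;
  vix_call_price : R -> R -> Omega -> R ;
  vix : Omega -> R ;

  spot_gt0 : forall t w, 0 <= t -> 0 < spot t w ;

  spot_adapted : forall t, 0 <= t ->
    measurable_fun setT (spot t : known info t -> R) ;
  put_adapted : forall t T', 0 <= t -> t <= T' ->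
    measurable_fun (setT `*` strikes)
      (fun z : known info t * R => put_price t z.2 T' z.1) ;
  call_adapted : forall t T', 0 <= t -> t <= T' ->
    measurable_fun (setT `*` strikes)
      (fun z : known info t * R => call_price t z.2 T' z.1) ;
  vix_call_adapted : forall t, 0 <= t -> t <= T ->
    measurable_fun (setT `*` strikes)
      (fun z : known info t * R => vix_call_price t z.2 z.1) ;

  put_maturity : forall T' K w, 0 <= T' -> 0 < K ->
    put_price T' K T' w = put_payoff K (spot T' w) ;
  call_maturity : forall T' K w, 0 <= T' -> 0 < K ->
    call_price T' K T' w = call_payoff K (spot T' w) ;
  vix_call_maturity : forall K w, 0 < K ->
    vix_call_price T K w = call_payoff K (vix w) ;

  vix_put_finite : forall w,
    finite_integral `]0, futures r spot T (T + tau) w[%classic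
      (fun K => put_price T K (T + tau) w / K ^+ 2) ;
  vix_call_finite : forall w,
    finite_integral `]futures r spot T (T + tau) w, +oo[%classic
      (fun K => call_price T K (T + tau) w / K ^+ 2) ;
  vix_ge0 : forall w, 0 <= vix w ;
  vix_sqr : forall w,
    vix w ^+ 2 =
    2 / (tau * bond r T (T + tau)) *
    (strike_integral `]0, futures r spot T (T + tau) w[%classic
       (fun K => put_price T K (T + tau) w / K ^+ 2) +
     strike_integral `]futures r spot T (T + tau) w, +oo[%classic
       (fun K => call_price T K (T + tau) w / K ^+ 2))
}.

Arguments market {d} Omega {R} r tau T.

Section Portfolios.
Context {d : measure_display} {Omega : measurableType d} {R : realType}.
Context {r tau T : R} (M : market Omega r tau T).

Definition Pi1_integrand (xi q t : R) (w : Omega) (K : R) : R :=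
  put_price M t K (T + tau) w / K `^ (xi_tilde tau xi * q + 2).

Definition Pi2_integrand (xi p t : R) (w : Omega) (K : R) : R :=
  call_price M t K T w / K `^ (2 - xi_tilde tau xi * p).

Definition Pi3_integrand (xi t : R) (w : Omega) (K : R) : R :=
  (2 * xi + 4 * xi ^+ 2 * K ^+ 2) * expR (xi * K ^+ 2) *
  vix_call_price M t K w.

Definition Pi1 (xi q t : R) (w : Omega) : R :=
  xi_tilde tau xi * (xi_tilde tau xi * q + 1) / bond r T (T + tau) *
  strike_integral strikes (Pi1_integrand xi q t w).

Definition Pi2 (xi p t : R) (w : Omega) : R :=
  xi_tilde tau xi * (xi_tilde tau xi * p - 1) /
    bond r T (T + tau) `^ (xi_tilde tau xi * p) *
  strike_integral strikes (Pi2_integrand xi p t w).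

Definition Pi3 (xi t : R) (w : Omega) : R :=
  bond r t T + strike_integral strikes (Pi3_integrand xi t w).

(* A static position opened at time [T] and held to [T + tau]: units of the
   bond and of the futures maturing at [T + tau] and of the underlying, and
   densities over strikes of puts and calls maturing at [T + tau].  Holdings
   may be negative and depend only on what is known at time [T]. *)
Record static_portfolio := StaticPortfolio {
  bond_units : Omega -> R ;
  spot_units : Omega -> R ;
  futures_units : Omega -> R ;
  put_density : Omega -> R -> R ;
  call_density : Omega -> R -> R ;

  bond_units_known :
    measurable_fun setT (bond_units : known (info M) T -> R) ;
  spot_units_known :
    measurable_fun setT (spot_units : known (info M) T -> R) ;
  futures_units_known :
    measurable_fun setT (futures_units : known (info M) T -> R) ;
  put_density_known :
    measurable_fun (setT `*` strikes)
      (fun z : known (info M) T * R => put_density z.1 z.2) ;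
  call_density_known :
    measurable_fun (setT `*` strikes)
      (fun z : known (info M) T * R => call_density z.1 z.2) ;

  put_cost_finite : forall w, finite_integral strikes
    (fun K => put_density w K * put_price M T K (T + tau) w) ;
  call_cost_finite : forall w, finite_integral strikes
    (fun K => call_density w K * call_price M T K (T + tau) w) ;
  put_payoff_finite : forall w, finite_integral strikes
    (fun K => put_density w K * put_payoff K (spot M (T + tau) w)) ;
  call_payoff_finite : forall w, finite_integral strikes
    (fun K => call_density w K * call_payoff K (spot M (T + tau) w))
}.

(* Entering a futures contract is free. *)
Definition entry_cost (h : static_portfolio) (w : Omega) : R :=
  bond_units h w * bond r T (T + tau) +
  spot_units h w * spot M T w +
  strike_integral strikes
    (fun K => put_density h w K * put_price M T K (T + tau) w) +
  strike_integral strikes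
    (fun K => call_density h w K * call_price M T K (T + tau) w).

Definition payoff (h : static_portfolio) (w : Omega) : R :=
  bond_units h w +
  spot_units h w * spot M (T + tau) w +
  futures_units h w * (spot M (T + tau) w - futures r (spot M) T (T + tau) w) +
  strike_integral strikes
    (fun K => put_density h w K * put_payoff K (spot M (T + tau) w)) +
  strike_integral strikes
    (fun K => call_density h w K * call_payoff K (spot M (T + tau) w)).

(* Cost and payoff are random variables, so both events below are measurable;
   the entry cost is known at time [T] but may depend on the state. *)
Definition arbitrage (Pr : probability Omega R) : Prop :=
  exists h : static_portfolio,
    [/\ forall w, entry_cost h w <= 0,
        forall w, 0 <= payoff h w &
        (0 < Pr [set w | (entry_cost h w < 0)%R])%E \/
        (0 < Pr [set w | (0 < payoff h w)%R])%E].

End Portfolios.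

(* Main.v *)
(* With [a := xi_tilde tau xi], [F] the futures price and [X] the spot price
   at [T + tau], the option portfolios collapse at time [T]: [Pi3] is
   [expR u] with [u := xi * VIX ^+ 2], and [Pi2] is at least
   [F `^ (a * p) / p] (with equality, but the lower bound suffices).  Young's
   inequality and the tangent of [expR] at [u] give
     F `^ (a * p) / p + X `^ (- (a * q)) / q >= expR (- a * ln (X / F))
                              >= expR u * (1 - u - a * ln (X / F)).
   Whenever [Pi3 > Pi1 + Pi2], hold the puts replicating the power claim and
   [Pi2] bonds, sell [expR u] units of the options strip that defines the VIX
   (with a futures position it pays [- ln (X / F)]), and short
   [expR u * (1 - u)] bonds: the payoff is nonnegative by the above, and the
   cost is [bond * (Pi1 + Pi2 - Pi3) < 0]. *)
Require Import Defs.
From mathcomp Require Import all_boot all_order all_algebra.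
From mathcomp Require Import all_classical all_reals all_analysis.
From mathcomp Require Import measurable_realfun ring lra.
Import Order.TTheory GRing.Theory Num.Theory.
Import numFieldNormedType.Exports.

Local Open Scope classical_set_scope.
Local Open Scope ring_scope.

(** * Integration over strikes: restriction, fundamental theorem of calculus, linearity *)

Section Integrals.
Context {R : realType}.
Notation mu := (@lebesgue_measure R).

Lemma measurable_strikes : measurable (@strikes R).
Proof. exact: measurable_itv. Qed.

Lemma mem_strikes (K : R) : (K \in strikes) = (0 < K).
Proof. by rewrite mem_setE in_itv/= andbT. Qed.

Lemma mem_below (F0 K : R) : 0 < K -> (K \in `]0, F0[%classic) = (K < F0).
Proof. by move=> K0; rewrite mem_setE in_itv/= K0. Qed.

Lemma mem_above (F0 K : R) : (K \in `]F0, +oo[%classic) = (F0 < K).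
Proof. by rewrite mem_setE in_itv/= andbT. Qed.

Lemma below_strikes (F0 : R) : `]0, F0[%classic `<=` strikes.
Proof. by move=> K; rewrite /strikes/= !in_itv/= andbT => /andP[]. Qed.

Lemma above_strikes (F0 : R) : 0 <= F0 -> `]F0, +oo[%classic `<=` strikes.
Proof.
by move=> F00 K; rewrite /strikes/= !in_itv/= !andbT; exact: le_lt_trans.
Qed.

(** An integral over a set is that of the zero extension over the line, so domain and integrand may
    change together. This trades an option payoff over all strikes for a smooth integrand on the
    interval where the payoff is nonzero. *)
Lemma eq_restrict_integral (D E : set R) (f g : R -> R) :
  measurable D -> measurable E -> f \_ D =1 g \_ E -> finite_integral E g ->
  finite_integral D f /\ strike_integral D f = strike_integral E g.
Proof.
rewrite /finite_integral => mD mE /funext fg ig; split.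
  have [_ ->//] := integrable_mkcond (mu := mu) (EFin \o f) mD.
  rewrite restrict_EFin fg -restrict_EFin.
  by have [->] := integrable_mkcond (mu := mu) (EFin \o g) mE.
by rewrite /strike_integral Rintegral_mkcond [RHS]Rintegral_mkcond fg.
Qed.

Lemma derivable_in_itv_continuous (f : R -> R) (i : interval R) :
  (forall x, x \in i -> derivable f x 1) -> {within [set` i], continuous f}.
Proof.
move=> df; apply: continuous_in_subspaceT => x /set_mem/df dfx.
exact/differentiable_continuous/derivable1_diffP.
Qed.

(** Derivability on the closed segment makes [f] continuous there, which gives integrability and the
    fundamental theorem; removing the two endpoints, a null set, changes nothing. *)
Lemma integral_itvoo_derive (f F : R -> R) (a b : R) : a <= b ->
  (forall x, x \in `[a, b] -> is_derive x 1 F (f x)) ->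
  (forall x, x \in `[a, b] -> derivable f x 1) ->
  finite_integral `]a, b[ f /\ strike_integral `]a, b[ f = F b - F a.
Proof.
rewrite le_eqVlt => /predU1P[<- _ _|ab dF df].
  rewrite /finite_integral /strike_integral set_itv_ge ?bnd_simp ?ltxx//.
  by rewrite Rintegral_set0 subrr; split => //; exact: integrable_set0.
have cf : {within `[a, b], continuous f} by exact: derivable_in_itv_continuous.
have icc : mu.-integrable `[a, b] (EFin \o f).
  by apply: continuous_compact_integrable => //; exact: segment_compact.
have ioo : mu.-integrable `]a, b[ (EFin \o f).
  apply: integrableS icc => //.
  by apply: set_interval.subset_itv; rewrite bnd_simp.
have ico : mu.-integrable `[a, b[ (EFin \o f).
  apply: integrableS icc => //.
  by apply: set_interval.subset_itv; rewrite bnd_simp.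
split => //.
have cF x : x \in `[a, b] -> {for x, continuous F}.
  move=> /dF dFx; apply/differentiable_continuous/derivable1_diffP.
  exact: ex_derive.
rewrite /strike_integral Rintegral_itv_obnd_cbnd// Rintegral_itv_bndo_bndc//.
rewrite /Rintegral (@continuous_FTC2 _ f F)//.
- split.
  + by move=> x /subset_itv_oo_cc/dF dFx; exact: ex_derive.
  + by apply/cvg_at_right_filter/cF; rewrite in_itv/= lexx ltW.
  + by apply/cvg_at_left_filter/cF; rewrite in_itv/= lexx ltW.
- by move=> x /subset_itv_oo_cc/dF dFx; rewrite derive1E derive_val.
Qed.

(** Since [f] is nonnegative, the integral of its absolute value is its own integral, so the finite
    value [l - F a] also yields integrability. *)
Lemma integral_itvoy_derive (f F : R -> R) (a l : R) :
  (forall x, a <= x -> 0 <= f x) ->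
  (forall x, a <= x -> is_derive x 1 F (f x)) ->
  (forall x, a <= x -> derivable f x 1) ->
  F x @[x --> +oo] --> l ->
  finite_integral `]a, +oo[ f /\ strike_integral `]a, +oo[ f = l - F a.
Proof.
move=> f0 dF df Fl.
have cF : {for a, continuous F}.
  apply/differentiable_continuous/derivable1_diffP.
  by have := dF _ (lexx a) => dFa; exact: ex_derive.
have cf : {within `[a, +oo[, continuous f}.
  by apply: derivable_in_itv_continuous => x; rewrite in_itv/= andbT => /df.
have H : (\int[mu]_(x in `[a, +oo[) (f x)%:E = l%:E - (F a)%:E)%E.
  apply: ge0_continuous_FTC2y => //.
  - by move=> x /ltW/dF dFx; exact: ex_derive.
  - exact: cvg_at_right_filter.
  - move=> x; rewrite in_itv/= andbT => /ltW/dF dFx.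
    by rewrite derive1E derive_val.
have icy : mu.-integrable `[a, +oo[ (EFin \o f).
  apply/integrableP; split.
    by apply/measurable_EFinP; exact: subspace_continuous_measurable_fun.
  under eq_integral => x.
    rewrite inE/= in_itv/= andbT => /f0 fx0; rewrite /= ger0_norm//; over.
  by rewrite H -EFinB ltry.
have ioy : mu.-integrable `]a, +oo[ (EFin \o f).
  apply: integrableS icy => //.
  by apply: set_interval.subset_itv; rewrite bnd_simp.
split => //.
by rewrite /strike_integral Rintegral_itv_obnd_cbnd// /Rintegral H.
Qed.

Lemma le_strike_integral (D : set R) (f g : R -> R) : measurable D ->
  finite_integral D f -> finite_integral D g -> (forall K, D K -> f K <= g K) ->
  strike_integral D f <= strike_integral D g.
Proof. by move=> mD ff fg; exact: (le_Rintegral (mu := mu) mD ff fg). Qed.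

Lemma finite_integralZl (D : set R) (f : R -> R) (c : R) : measurable D ->
  finite_integral D f -> finite_integral D (fun K => c * f K).
Proof. by move=> mD ff; exact: (integrableZl (mu := mu) mD c ff). Qed.

Lemma strike_integralZl (D : set R) (f : R -> R) (c : R) : measurable D ->
  finite_integral D f ->
  strike_integral D (fun K => c * f K) = c * strike_integral D f.
Proof. by move=> mD ff; exact: (RintegralZl (mu := mu) c mD ff). Qed.

Lemma finite_integralD (D : set R) (f g : R -> R) : measurable D ->
  finite_integral D f -> finite_integral D g ->
  finite_integral D (fun K => f K + g K).
Proof. by move=> mD ff fg; exact: (integrableD (mu := mu) mD ff fg). Qed.

Lemma strike_integralD (D : set R) (f g : R -> R) : measurable D ->
  finite_integral D f -> finite_integral D g ->
  strike_integral D (fun K => f K + g K) =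
  strike_integral D f + strike_integral D g.
Proof. by move=> mD ff fg; exact: (RintegralD (mu := mu) mD ff fg). Qed.

Lemma restrict_strikes (D : set R) (g : R -> R) : D `<=` strikes ->
  (fun K => (K \in D)%:R * g K) \_ strikes =1 g \_ D.
Proof.
move=> DS K; rewrite /patch; have [KD|KD] := boolP (K \in D).
  by rewrite (mem_set (DS _ (set_mem KD))) mul1r.
by rewrite mul0r if_same.
Qed.

(** Turns a domain into an indicator factor. When [D] depends on the state, this leaves an integral
    over a fixed domain, whose measurability in the state can be studied. *)
Lemma strike_integral_sub (D : set R) (g : R -> R) : D `<=` strikes ->
  strike_integral D g = strike_integral strikes (fun K => (K \in D)%:R * g K).
Proof.
move=> /(restrict_strikes _ g)/funext gE.
by rewrite /strike_integral Rintegral_mkcond [RHS]Rintegral_mkcond gE.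
Qed.

Lemma eq_strike_integral (f g : R -> R) : (forall K, 0 < K -> f K = g K) ->
  strike_integral strikes f = strike_integral strikes g.
Proof. by move=> fg; apply: eq_Rintegral => K; rewrite mem_strikes => /fg. Qed.

(** The common shape of the option holdings: a weight on all strikes plus a multiple of the strip
    cut off at the futures price. *)
Lemma integral_comb (D : set R) (f g h : R -> R) (c1 c2 : R) :
  measurable D -> D `<=` strikes ->
  finite_integral strikes f -> finite_integral D g ->
  (forall K, 0 < K -> h K = c1 * f K + c2 * ((K \in D)%:R * g K)) ->
  finite_integral strikes h /\
  strike_integral strikes h = c1 * strike_integral strikes f +
                              c2 * strike_integral D g.
Proof.
move=> mD DS ff fg hE.
have [fgD <-] := eq_restrict_integral _ _ _ _ measurable_strikes mD
  (restrict_strikes _ g DS) fg.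
have mS := measurable_strikes.
have [] := eq_restrict_integral strikes strikes h
  (fun K => c1 * f K + c2 * ((K \in D)%:R * g K)) mS mS.
- by move=> K; rewrite /patch mem_strikes; case: ifPn => // /hE.
- by apply: finite_integralD => //; exact: finite_integralZl.
move=> fh ->; split => //.
by rewrite strike_integralD// ?strike_integralZl//; exact: finite_integralZl.
Qed.

End Integrals.

#[local] Hint Resolve measurable_strikes : core.

(** * Closed forms and bounds for integrals of option payoffs *)

Section Payoffs.
Context {R : realType}.

Lemma is_derive_mull_powR (c e x : R) : 0 < x ->
  is_derive x 1 (fun K => c * K `^ e) (c * (e * x `^ (e - 1))).
Proof.
by move=> x0; have H := is_derive1_powR e x0; exact: is_deriveZ.
Qed.

Lemma derivable_mull_powR (c e x : R) : 0 < x ->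
  derivable (fun K => c * K `^ e) x 1.
Proof. by move=> /(is_derive_mull_powR c e) H; exact: ex_derive. Qed.

Lemma powR1D (x e : R) : 0 < x -> x `^ (1 + e) = x * x `^ e.
Proof. by move=> x0; rewrite powRD ?(gt_eqF x0) ?implybT// powRr1 ?(ltW x0). Qed.

Lemma cvgy_powRN (e : R) : 0 < e -> K `^ (- e) @[K --> +oo] --> (0 : R).
Proof.
move=> e0; apply/cvgrPdist_le => d d0; near=> K.
have dK : d^-1 `^ e^-1 <= K by near: K; exact: nbhs_pinfty_ge.
rewrite sub0r normrN ger0_norm ?powR_ge0// powRN -[leRHS]invrK.
have d'0 : 0 < d^-1 by rewrite invr_gt0.
have K0 : 0 < K by apply: lt_le_trans dK; rewrite powR_gt0.
rewrite lef_pV2 ?posrE ?powR_gt0//.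
rewrite -[leLHS]powRr1 ?(ltW d'0)// -(mulVf (lt0r_neq0 e0)) powRrM.
by rewrite ge0_ler_powR ?nnegrE ?powR_ge0// ltW.
Unshelve. all: by end_near. Qed.

(** The payoff vanishes for strikes below [X]; beyond it the integrand is the power sum [g], whose
    antiderivative [G] tends to 0 at infinity, so the value is [- G X]. With [b = a * q] this is the
    payoff of the puts in [Pi1]. *)
Lemma put_powR_integral (b X : R) : 0 < b -> 0 < X ->
  finite_integral strikes (fun K => put_payoff K X / K `^ (b + 2)) /\
  strike_integral strikes (fun K => put_payoff K X / K `^ (b + 2)) =
    X `^ (- b) / (b * (b + 1)).
Proof.
move=> b0 X0.
pose g (K : R) := K `^ (- b - 1) - X * K `^ (- b - 2).
pose G (K : R) := - b^-1 * K `^ (- b) + X / (b + 1) * K `^ (- b - 1).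
have [fg Ig] : finite_integral `]X, +oo[ g /\
    strike_integral `]X, +oo[ g = 0 - G X.
  apply: integral_itvoy_derive.
  - move=> K XK; have K0 := lt_le_trans X0 XK.
    rewrite /g; have -> : - b - 1 = 1 + (- b - 2) by ring.
    rewrite powR1D// -mulrBl.
    by rewrite mulr_ge0 ?powR_ge0 ?subr_ge0.
  - move=> K XK; have K0 := lt_le_trans X0 XK.
    apply: is_derive_eq.
      by apply: is_deriveD; exact: is_derive_mull_powR.
    rewrite /g (_ : - b - 1 - 1 = - b - 2); last by ring.
    by field; apply/andP; split; apply/eqP; lra.
  - move=> K XK; have K0 := lt_le_trans X0 XK.
    rewrite /g; apply: derivableB; last exact: derivable_mull_powR.
    by have H := is_derive1_powR (- b - 1) K0; exact: ex_derive.
  - have : G K @[K --> +oo] --> - b^-1 * 0 + X / (b + 1) * (0 : R).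
      apply: cvgD; (apply: cvgM; first exact: cvg_cst).
        exact: cvgy_powRN.
      rewrite (_ : - b - 1 = - (b + 1)); last by ring.
      by apply: cvgy_powRN; lra.
    by rewrite !mulr0 addr0.
have [||| | fs Is] := eq_restrict_integral strikes `]X, +oo[
    (fun K => put_payoff K X / K `^ (b + 2)) g => //.
  move=> K; rewrite /patch mem_strikes mem_setE in_itv/= andbT /put_payoff.
  have [K0|K0] := ltP 0 K; last by rewrite ltNge (le_trans K0 (ltW X0)).
  have [XK|KX] := ltP X K; last by rewrite max_r ?mul0r// subr_le0.
  rewrite max_l ?subr_ge0 ?(ltW XK)// /g -powRN.
  have -> : - b - 1 = 1 + (- b - 2) by ring.
  rewrite powR1D// -mulrBl.
  by congr (_ * _ `^ _); ring.
split => //; rewrite Is Ig /G.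
have -> : - b = 1 + (- b - 1) by ring.
rewrite powR1D//.
have -> : 1 + (- b - 1) - 1 = - b - 1 by ring.
by field; apply/andP; split; apply/eqP; lra.
Qed.

(* For [b < 2] the integrand is unbounded at 0: integrate over [`]c, S[] and let
   [c] tend to 0. *)
Lemma call_powR_integral_ge (b S : R) : 1 < b -> 0 < S ->
  finite_integral strikes (fun K => call_payoff K S / K `^ (2 - b)) ->
  S `^ b / ((b - 1) * b) <=
    strike_integral strikes (fun K => call_payoff K S / K `^ (2 - b)).
Proof.
move=> b1 S0 fin.
pose g (K : R) := S * K `^ (b - 2) - K `^ (b - 1).
pose G (K : R) := S / (b - 1) * K `^ (b - 1) + (- b^-1) * K `^ b.
set I := strike_integral _ _.
have GE : G S = S `^ b / ((b - 1) * b).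
  rewrite /G -[X in S / _ * S `^ (b - 1) + - X^-1 * S `^ X]/b.
  have -> : S `^ b = S * S `^ (b - 1).
    by rewrite -powR1D//; congr (_ `^ _); ring.
  by field; apply/andP; split; apply/eqP; lra.
(* The nonnegative integrand dominates the zero extension of [g] from []c, S[], whose integral is
   [G S - G c]. *)
have H c : 0 < c -> c <= S -> G S - G c <= I.
  move=> c0 cS.
  have [] := @integral_itvoo_derive _ g G c S cS.
  - move=> K; rewrite in_itv/= => /andP[cK KS]; have K0 := lt_le_trans c0 cK.
    apply: is_derive_eq.
      by apply: is_deriveD; exact: is_derive_mull_powR.
    rewrite /g (_ : b - 1 - 1 = b - 2); last by ring.
    by field; apply/andP; split; apply/eqP; lra.
  - move=> K; rewrite in_itv/= => /andP[cK KS]; have K0 := lt_le_trans c0 cK.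
    rewrite /g; apply: derivableB; first exact: derivable_mull_powR.
    by have D := is_derive1_powR (b - 1) K0; exact: ex_derive.
  move=> fg <-.
  have [||| | fs <-] :=
    eq_restrict_integral strikes `]c, S[ (g \_ `]c, S[) g => //.
    move=> K; rewrite /patch mem_strikes mem_setE in_itv/=.
    case: ifPn => // /negbTE K0; case: ifPn => // /andP[cK].
    by rewrite (lt_trans c0 cK) in K0.
  apply: (le_strike_integral _ _ _ measurable_strikes fs fin).
  move=> K; rewrite /strikes/= in_itv/= andbT => K0.
  rewrite /patch mem_setE in_itv/=; case: ifPn => [/andP[cK KS]|_].
    rewrite /g /call_payoff max_l ?subr_ge0 ?(ltW KS)// -powRN opprB.
    by rewrite (_ : b - 1 = 1 + (b - 2)) ?powR1D// ?mulrBl//; ring.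
  by rewrite mulr_ge0 ?invr_ge0 ?powR_ge0// /call_payoff le_max lexx orbT.
rewrite -GE -(addr0 I) -lerBlDl.
(* It suffices to find [c] with [G c <= e]: the second term of [G c] is nonpositive, and the first
   tends to 0 with [c] because [b > 1]. *)
apply/ler_addgt0Pl => e e0.
have : S / (b - 1) * c `^ (b - 1) @[c --> 0^'+] --> S / (b - 1) * 0.
  by apply: cvgM; [exact: cvg_cst|apply: powR_cvg0; rewrite subr_gt0].
rewrite mulr0 => /cvgrPdist_le /(_ e e0) near_e.
have [c [c0 cS ce]] : exists c,
    [/\ 0 < c, c <= S & S / (b - 1) * c `^ (b - 1) <= e].
  near (0 : R)^'+ => c; exists c.
  split; [by near: c; exact: nbhs_right_gt|by near: c; exact: nbhs_right_le|].
  have : `|0 - S / (b - 1) * c `^ (b - 1)| <= e by near: c.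
  by rewrite sub0r normrN => /(le_trans (ler_norm _)).
rewrite addr0; apply: le_trans (_ : G S - (G S - G c) <= _).
  by rewrite lerD2l lerN2 H.
rewrite opprB addrC subrK /G -[leRHS]addr0 lerD//.
by rewrite mulNr oppr_le0 mulr_ge0 ?powR_ge0// invr_ge0; lra.
Unshelve. all: by end_near. Qed.

(** Taylor's formula at 0 with integral remainder for [f K = expR (xi * K ^+ 2)]: the weight is the
    second derivative of [f], and the first derivative vanishes at 0. *)
Lemma call_expR_sqr_integral (xi v : R) : 0 <= v ->
  strike_integral strikes (fun K =>
    (2 * xi + 4 * xi ^+ 2 * K ^+ 2) * expR (xi * K ^+ 2) * call_payoff K v) =
  expR (xi * v ^+ 2) - 1.
Proof.
move=> v0.
pose g (K : R) := (2 * xi + 4 * xi ^+ 2 * K ^+ 2) * expR (xi * K ^+ 2) * (v - K).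
(* With [f] the exponential, this is [f' K * (v - K) + f K]; its derivative is [f'' K * (v - K)],
   the two [f'] terms cancelling. *)
pose G (K : R) := (2 * xi * K * (v - K) + 1) * expR (xi * K ^+ 2).
have de (K : R) : is_derive K 1 (fun K => expR (xi * K ^+ 2))
    (2 * xi * K * expR (xi * K ^+ 2)).
  have dq : is_derive K 1 (fun K : R => xi * K ^+ 2) (2 * xi * K).
    by apply: is_derive_eq; rewrite /GRing.scale /=; ring.
  have := is_derive1_comp (f := expR) (g := fun K => xi * K ^+ 2)
    (is_derive_expR _) dq.
  by rewrite mulrC.
have [fg Ig] : finite_integral `]0, v[ g /\ strike_integral `]0, v[ g = G v - G 0.
  apply: integral_itvoo_derive => // K _.
  by apply: is_derive_eq; rewrite /GRing.scale /g /=; ring.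
have [||| | _ ->] := eq_restrict_integral strikes `]0, v[ (fun K =>
    (2 * xi + 4 * xi ^+ 2 * K ^+ 2) * expR (xi * K ^+ 2) * call_payoff K v)
    g => //.
  move=> K; rewrite /patch mem_strikes mem_setE in_itv/= /call_payoff.
  case: ifPn => [K0|_]//; have [Kv|vK] := ltP K v.
    by rewrite max_l// subr_ge0 ltW.
  by rewrite max_r ?mulr0// subr_le0.
by rewrite Ig /G expr0n/= !mulr0 mul0r expR0 subrr mulr0 add0r !mul1r.
Qed.

Lemma log_integral (X a b : R) : 0 < a -> a <= b ->
  finite_integral `]a, b[ (fun K => (K - X) / K ^+ 2) /\
  strike_integral `]a, b[ (fun K => (K - X) / K ^+ 2) =
    ln b + X / b - (ln a + X / a).
Proof.
move=> a0 ab; have pos K : K \in `[a, b] -> 0 < K.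
  by rewrite in_itv/= => /andP[/(lt_le_trans a0)].
have dV (K : R) : 0 < K -> is_derive K 1 (@GRing.inv R) (- K ^- 2).
  move=> /lt0r_neq0 K0; split; first exact: derivableV.
  by rewrite deriveV// derive_id /GRing.scale/= mulr1.
apply: (@integral_itvoo_derive _ _ (fun K => ln K + X * K^-1)) => // K /pos K0.
  have D := is_derive1_ln K0; have D' := dV _ K0.
  by apply: is_derive_eq; rewrite /GRing.scale/=; field; rewrite lt0r_neq0.
apply: derivableM; first exact: ex_derive.
by apply: derivableV => //; rewrite expf_neq0// lt0r_neq0.
Qed.

(** The put part lives on []X, F[] and the call part on []F, X[], so at most one is nonzero. The
    integrands being opposite, both orders of [F] and [X] give one formula: the log contract plus
    the term [X / F - 1], which a futures position can offset. *)
Lemma log_contract_integrals (F X : R) : 0 < F -> 0 < X ->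
  [/\ finite_integral `]0, F[ (fun K => put_payoff K X / K ^+ 2),
      finite_integral `]F, +oo[ (fun K => call_payoff K X / K ^+ 2) &
      strike_integral `]0, F[ (fun K => put_payoff K X / K ^+ 2) +
      strike_integral `]F, +oo[ (fun K => call_payoff K X / K ^+ 2) =
        ln F - ln X + X / F - 1].
Proof.
move=> F0 X0.
pose g (K : R) := (K - X) / K ^+ 2.
pose h (K : R) := (X - K) / K ^+ 2.
have putE : (fun K => put_payoff K X / K ^+ 2) \_ `]0, F[ =1 g \_ `]X, F[.
  move=> K; rewrite /patch !mem_setE !in_itv/= /put_payoff.
  have [XK|KX]/= := ltP X K.
    by rewrite (lt_trans X0 XK)/= max_l// subr_ge0 ltW.
  by rewrite max_r ?mul0r ?subr_le0// if_same.
have callE : (fun K => call_payoff K X / K ^+ 2) \_ `]F, +oo[ =1 h \_ `]F, X[.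
  move=> K; rewrite /patch !mem_setE !in_itv/= andbT /call_payoff.
  have [KX|XK]/= := ltP K X.
    by rewrite andbT max_l// subr_ge0 ltW.
  by rewrite andbF max_r ?mul0r ?subr_le0// if_same.
have gh : h = \- g by apply/funext => K; rewrite /h /g /= -mulNr opprB.
have zero (a b : R) k : b <= a ->
    finite_integral `]a, b[ k /\ strike_integral `]a, b[ k = 0.
  move=> ba; rewrite /finite_integral /strike_integral.
  rewrite set_itv_ge ?bnd_simp -?leNgt//.
  by rewrite Rintegral_set0; split => //; exact: integrable_set0.
have [fp Ip] : finite_integral `]X, F[ g /\
    strike_integral `]X, F[ g =
      if X <= F then ln F + X / F - (ln X + X / X) else 0.
  by case: leP => [XF|/ltW FX]; [exact: log_integral|exact: zero].
have [fc Ic] : finite_integral `]F, X[ h /\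
    strike_integral `]F, X[ h =
      if X <= F then 0 else ln F + X / F - (ln X + X / X).
  case: leP => [XF|/ltW FX]; first exact: zero.
  have [fg Ig] := log_integral X _ _ F0 FX.
  rewrite gh; split; first exact: (integrableN fg).
  rewrite -[RHS]opprB -Ig -mulN1r -strike_integralZl//.
  by apply: eq_Rintegral => K _; rewrite mulN1r.
have [fP ->] := eq_restrict_integral _ _ _ _
  (measurable_itv _) (measurable_itv _) putE fp.
have [fC ->] := eq_restrict_integral _ _ _ _
  (measurable_itv _) (measurable_itv _) callE fc.
split=> //; rewrite Ip Ic divff ?lt0r_neq0//.
by case: ifPn => _; ring.
Qed.

(** Young's inequality for [x]^ al[and]y [^ (- al)], followed by the tangent of [expR] at [u]. The
    tangent makes the lower bound affine in [ln x - ln y], hence payable by bonds and a log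
    contract. *)
Lemma young_exp (x y p q u al : R) : 0 < x -> 0 < y -> 0 < p -> 0 < q ->
  1 / p + 1 / q = 1 ->
  expR u * (1 - u + al * (ln x - ln y)) <=
  x `^ (al * p) / p + y `^ (- (al * q)) / q.
Proof.
move=> x0 y0 p0 q0; rewrite !div1r => pq.
apply: le_trans (_ : x `^ al * y `^ (- al) <= _); last first.
  rewrite powRrM -mulNr powRrM.
  by apply: conjugate_powR => //; exact: powR_ge0.
rewrite /powR !gt_eqF// -expRD.
(* Factoring out [expR u] reduces the tangent bound at [u] to [1 + v <= expR v]. *)
rewrite (_ : al * ln x + _ = u + (al * (ln x - ln y) - u)); last by ring.
rewrite expRD ler_pM2l ?expR_gt0//.
by have := expR_ge1Dx (al * (ln x - ln y) - u); lra.
Qed.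

End Payoffs.

(** * Measurability in the state of integrals over strikes *)

Section Measurability.
Context {d : measure_display} {U : measurableType d} {R : realType}.
Notation mu := (@lebesgue_measure R).

(** Tonelli's theorem handles nonnegative integrands; it is applied to the positive and negative
    parts, which are then subtracted. *)
Lemma measurable_Rintegral2 (f : U * R -> R) : measurable_fun setT f ->
  measurable_fun setT (fun u => (\int[mu]_K f (u, K))%R).
Proof.
move=> mf; have mEf : measurable_fun setT (EFin \o f) by exact/measurable_EFinP.
rewrite /Rintegral; apply: measurableT_comp => //.
under eq_fun => u do rewrite integralE.
have mint (g : U * R -> \bar R) :
    measurable_fun setT g -> (forall z, 0 <= g z)%E ->
    measurable_fun setT (fun u => \int[mu]_K g (u, K))%E.
  exact: (@measurable_fun_fubini_tonelli_F _ _ U (measurableTypeR R) R mu).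
apply: emeasurable_funB.
  have := mint _ (measurable_funepos mEf) (funepos_ge0 (EFin \o f)).
  congr measurable_fun; apply/funext => u; apply: eq_integral => K _.
  by rewrite !funeposE.
have := mint _ (measurable_funeneg mEf) (funeneg_ge0 (EFin \o f)).
congr measurable_fun; apply/funext => u; apply: eq_integral => K _.
by rewrite !funenegE.
Qed.

Lemma measurable_strike_integral (f : U * R -> R) :
  measurable_fun (setT `*` strikes) f ->
  measurable_fun setT (fun u => strike_integral strikes (fun K => f (u, K))).
Proof.
move=> mf; under eq_fun => u do rewrite /strike_integral Rintegral_mkcond.
have mS : measurable (setT `*` strikes : set (U * R)) by exact: measurableX.
have /measurable_Rintegral2 : measurable_fun setT (f \_ (setT `*` strikes)).
  by apply/(measurable_restrict _ _ _).1 => //; rewrite setTI.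
congr measurable_fun; apply/funext => u; apply: eq_Rintegral => K _.
by rewrite /patch in_setX in_setT.
Qed.

Lemma measurable_ltr_natr (D : set U) (f g : U -> R) :
  measurable_fun D f -> measurable_fun D g ->
  measurable_fun D (fun v => (f v < g v)%R%:R : R).
Proof.
move=> mf mg.
have mb : measurable_fun setT (fun b : bool => b%:R : R) by [].
exact: measurableT_comp mb (measurable_fun_ltr mf mg).
Qed.

(** On positive values the inverse is the power of exponent -1, a measurable function. *)
Lemma measurable_inv_gt0 (D : set U) (f : U -> R) :
  (forall v, D v -> 0 < f v) ->
  measurable_fun D f -> measurable_fun D (fun v => (f v)^-1).
Proof.
move=> f0 mf; apply: (@eq_measurable_fun _ _ _ _ _ (fun v => f v `^ (-1))).
  by move=> v /set_mem/f0 fv0; rewrite powR_inv1// ltW.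
exact: measurableT_comp (measurable_powR (-1)) mf.
Qed.

End Measurability.

(** * Measurability of the weights in the strike *)

Section StrikeWeights.
Context {d : measure_display} {U : measurableType d} {R : realType}.

Lemma measurable_strike_powRV (e : R) :
  measurable_fun (setT `*` strikes) (fun z : U * R => (z.2 `^ e)^-1).
Proof.
under eq_fun do rewrite -powRN.
apply: measurable_funTS.
exact: measurableT_comp (measurable_powR (- e)) measurable_snd.
Qed.

Lemma measurable_strike_sqrV :
  measurable_fun (setT `*` strikes) (fun z : U * R => (z.2 ^+ 2)^-1).
Proof.
apply: measurable_inv_gt0.
  by move=> z [_]; rewrite /strikes/= in_itv/= andbT => z0; rewrite exprn_gt0.
by apply: measurable_funTS; exact: measurable_funX _ measurable_snd.
Qed.

End StrikeWeights.

(** * The portfolios at time [T]: values, bounds and measurability *)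

Section Strategy.
Context {d : measure_display} {Omega : measurableType d} {R : realType}.
Context {r tau T : R} (M : market Omega r tau T).

Local Notation B := (bond r T (T + tau)).
Local Notation F := (futures r (spot M) T (T + tau)).
Local Notation a := (xi_tilde tau).

Lemma bond_gt0 (t t' : R) : 0 < bond r t t'.
Proof. exact: expR_gt0. Qed.

Lemma futures_gt0 w : 0 <= T -> 0 < F w.
Proof. by move=> T0; rewrite divr_gt0 ?bond_gt0//; exact: spot_gt0. Qed.

(** Since the spot is the futures price times the bond price, this lets the bond power dividing
    [Pi2] convert spot powers into futures powers. *)
Lemma powR_futures (e : R) w : 0 <= T -> F w `^ e * B `^ e = spot M T w `^ e.
Proof.
move=> T0; rewrite -powRM ?(ltW (futures_gt0 _ _))// ?(ltW (bond_gt0 _ _))//.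
by rewrite divfK// gt_eqF// bond_gt0.
Qed.

Lemma Pi3E (xi : R) w : Pi3 M xi T w = expR (xi * vix M w ^+ 2).
Proof.
(* The bond at maturity is worth 1, which cancels the [- 1] of the Taylor formula. *)
rewrite /Pi3 /bond subrr mulr0 expR0.
rewrite (_ : strike_integral _ _ = expR (xi * vix M w ^+ 2) - 1); first by ring.
rewrite -call_expR_sqr_integral ?vix_ge0//; apply: eq_strike_integral => K K0.
by rewrite /Pi3_integrand vix_call_maturity.
Qed.

(** Calls expiring at [T] are worth their payoffs, so the lower bound for call payoffs applies with
    [b = a xi * p]; the prefactor of [Pi2] then reduces [spot]^ b / ((b - 1) * b)[to]F [^ b / p]. *)
Lemma Pi2_ge (xi p : R) w : 0 <= T -> 0 < p -> 1 < a xi * p ->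
  finite_integral strikes (Pi2_integrand M xi p T w) ->
  F w `^ (a xi * p) / p <= Pi2 M xi p T w.
Proof.
move=> T0 p0 ap1 fin; have S0 := spot_gt0 M w T0.
have B0 : 0 < B `^ (a xi * p) by rewrite powR_gt0 ?bond_gt0.
pose g K := call_payoff K (spot M T w) / K `^ (2 - a xi * p).
have IE : strike_integral strikes (Pi2_integrand M xi p T w) =
    strike_integral strikes g.
  by apply: eq_strike_integral => K K0; rewrite /Pi2_integrand call_maturity.
have fin' : finite_integral strikes g.
  have mS := @measurable_strikes R.
  apply: (eq_restrict_integral _ _ _ _ mS mS _ fin).1 => K.
  rewrite /patch mem_strikes /Pi2_integrand.
  by case: ifPn => // K0; rewrite call_maturity.
have a0 : 0 < a xi by rewrite -(pmulr_lgt0 _ p0); lra.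
have := call_powR_integral_ge _ _ ap1 S0 fin'; rewrite -IE -(powR_futures _ _ T0).
rewrite /Pi2 => H.
apply: le_trans (ler_wpM2l _ H); last first.
  by rewrite divr_ge0 ?(ltW B0)// mulr_ge0 ?(ltW a0)// subr_ge0 ltW.
rewrite le_eqVlt; apply/orP; left; apply/eqP; field.
by do ?[apply/andP; split]; apply/eqP; lra.
Qed.

Lemma futures_known : 0 <= T -> measurable_fun setT (F : known (info M) T -> R).
Proof.
by move=> T0; apply: measurable_funM => //; exact: spot_adapted.
Qed.

Lemma Pi1_known (xi q : R) : 0 <= T -> 0 <= tau ->
  measurable_fun setT (Pi1 M xi q T : known (info M) T -> R).
Proof.
move=> T0 tau0; apply: measurable_funM => //.
apply: (measurable_strike_integral
  (fun z : known (info M) T * R => Pi1_integrand M xi q T z.1 z.2)).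
apply: measurable_funM; last exact: measurable_strike_powRV.
by apply: put_adapted => //; rewrite lerDl.
Qed.

Lemma Pi2_known (xi p : R) : 0 <= T ->
  measurable_fun setT (Pi2 M xi p T : known (info M) T -> R).
Proof.
move=> T0; apply: measurable_funM => //.
apply: (measurable_strike_integral
  (fun z : known (info M) T * R => Pi2_integrand M xi p T z.1 z.2)).
apply: measurable_funM; last exact: measurable_strike_powRV.
exact: call_adapted.
Qed.

(** Measurability is read off the replication formula. Its domains end at the random [F w], so they
    are first rewritten as indicators inside integrals over all strikes. *)
Lemma vix_sqr_known : 0 <= T -> 0 <= tau ->
  measurable_fun setT ((fun w => vix M w ^+ 2) : known (info M) T -> R).
Proof.
move=> T0 tau0; have TT : T <= T + tau by rewrite lerDl.
pose P (z : known (info M) T * R) :=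
  (z.2 < F z.1)%R%:R * (put_price M T z.2 (T + tau) z.1 / z.2 ^+ 2).
pose C (z : known (info M) T * R) :=
  (F z.1 < z.2)%R%:R * (call_price M T z.2 (T + tau) z.1 / z.2 ^+ 2).
under eq_fun => w.
  rewrite vix_sqr (strike_integral_sub _ _ (@below_strikes R (F w))).
  rewrite (strike_integral_sub _ _ (above_strikes _ (ltW (futures_gt0 _ T0)))).
  rewrite (eq_strike_integral _ (fun K => P (w, K))); last first.
    by move=> K K0; rewrite mem_below.
  rewrite [X in _ * (_ + X)](eq_strike_integral _ (fun K => C (w, K)));
    last first.
    by move=> K K0; rewrite mem_above.
  over.
have mF : measurable_fun (setT `*` strikes)
    (fun z : known (info M) T * R => F z.1).
  apply: measurable_funTS.
  exact: measurableT_comp (futures_known T0) measurable_fst.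
have mK : measurable_fun (setT `*` strikes) (fun z : known (info M) T * R => z.2).
  by apply: measurable_funTS; exact: measurable_snd.
apply: measurable_funM => //; apply: measurable_funD.
  apply: (measurable_strike_integral P).
  apply: measurable_funM; first exact: measurable_ltr_natr.
  by apply: measurable_funM; [exact: put_adapted|exact: measurable_strike_sqrV].
apply: (measurable_strike_integral C).
apply: measurable_funM; first exact: measurable_ltr_natr.
by apply: measurable_funM; [exact: call_adapted|exact: measurable_strike_sqrV].
Qed.

End Strategy.

(** * The arbitrage: holdings, their measurability, cost and payoff *)

Theorem proposition3p5 (R : realType) (d : measure_display)
  (Omega : measurableType d) (Pr : probability Omega R)
  (r tau T : R) (r_ge0 : 0 <= r) (tau_gt0 : 0 < tau) (T_gt0 : 0 < T)
  (M : market Omega r tau T)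
  (xi p q : R) (xi_gt0 : 0 < xi) (p_gt1 : 1 < p) (q_gt1 : 1 < q)
  (pq : 1 / p + 1 / q = 1) (xip_gt1 : 1 < xi_tilde tau xi * p)
  (Pi1_finite : forall w, finite_integral strikes (Pi1_integrand M xi q T w))
  (Pi2_finite : forall w, finite_integral strikes (Pi2_integrand M xi p T w))
  (Pi3_finite : forall w, finite_integral strikes (Pi3_integrand M xi T w))
  (reversed : (0 < Pr [set w | (Pi3 M xi T w >
                                Pi1 M xi q T w + Pi2 M xi p T w)%R])%E) :
  arbitrage M Pr.
Proof.
have T0 := ltW T_gt0; have tau0 := ltW tau_gt0.
have TT : T <= T + tau by rewrite lerDl.
have T'0 : 0 <= T + tau by exact: le_trans TT.
have p0 : 0 < p by lra.
have q0 : 0 < q by lra.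
set a := xi_tilde tau xi in xip_gt1 *.
have a0 : 0 < a by rewrite divr_gt0// mulr_gt0.
have aq0 : 0 < a * q by rewrite mulr_gt0.
pose B := bond r T (T + tau); have B0 : 0 < B := bond_gt0 _ _.
pose F := futures r (spot M) T (T + tau).
have F0 w : 0 < F w by exact: futures_gt0.
pose u w := xi * vix M w ^+ 2.
pose E w := expR (u w).
(* Indicator of the reversed inequality, known at [T]. It scales every holding, so elsewhere nothing
   is held and the cost is 0. *)
pose c w : R := (Pi1 M xi q T w + Pi2 M xi p T w < E w)%R%:R.
pose C1 := a * (a * q + 1).
pose put_dens w K :=
  c w * (C1 * (K `^ (a * q + 2))^-1 - a * E w * ((K < F w)%R%:R * (K ^+ 2)^-1)).
pose call_dens w K := - (c w * (a * E w)) * ((F w < K)%R%:R * (K ^+ 2)^-1).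
pose X w := spot M (T + tau) w; have X0 w : 0 < X w by exact: spot_gt0.
(* [V] is left free: listed prices give the cost, payoffs the terminal value. *)
have put_comb w (V : R -> R) :
    finite_integral strikes (fun K => V K / K `^ (a * q + 2)) ->
    finite_integral `]0, F w[ (fun K => V K / K ^+ 2) ->
    finite_integral strikes (fun K => put_dens w K * V K) /\
    strike_integral strikes (fun K => put_dens w K * V K) =
      c w * C1 * strike_integral strikes (fun K => V K / K `^ (a * q + 2)) +
      - (c w * (a * E w)) * strike_integral `]0, F w[ (fun K => V K / K ^+ 2).
  move=> fV fV2; apply: integral_comb => //; first exact: below_strikes.
  by move=> K K0; rewrite mem_below// /put_dens; ring.
have call_comb w (V : R -> R) :
    finite_integral `]F w, +oo[ (fun K => V K / K ^+ 2) ->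
    finite_integral strikes (fun K => call_dens w K * V K) /\
    strike_integral strikes (fun K => call_dens w K * V K) =
      - (c w * (a * E w)) * strike_integral `]F w, +oo[ (fun K => V K / K ^+ 2).
  (* Calls carry no power weight, so the first term is a zero integrand with coefficient 0. *)
  move=> fV2; rewrite -[X in _ = X]add0r.
  rewrite -(mul0r (strike_integral strikes (cst 0))).
  apply: integral_comb => //; first exact/above_strikes/ltW.
    exact: integrable0.
  by move=> K K0; rewrite mem_above// /call_dens; ring.
have put_cost w := put_comb w (fun K => put_price M T K (T + tau) w)
  (Pi1_finite w) (vix_put_finite M w).
have call_cost w := call_comb w (fun K => call_price M T K (T + tau) w)
  (vix_call_finite M w).
have log w := log_contract_integrals _ _ (F0 w) (X0 w).
have pow w := put_powR_integral _ _ aq0 (X0 w).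
have put_pay w := put_comb w (fun K => put_payoff K (X w)) (pow w).1
  (let: And3 H _ _ := log w in H).
have call_pay w := call_comb w (fun K => call_payoff K (X w))
  (let: And3 _ H _ := log w in H).
have mE : measurable_fun setT (E : known (info M) T -> R).
  apply: measurableT_comp => //; apply: measurable_funM => //.
  exact: vix_sqr_known.
have mc : measurable_fun setT (c : known (info M) T -> R).
  apply: measurable_ltr_natr => //; apply: measurable_funD.
    exact: Pi1_known.
  exact: Pi2_known.
have mF := futures_known M T0.
have lift (f : known (info M) T -> R) : measurable_fun setT f ->
    measurable_fun (setT `*` strikes) (fun z : known (info M) T * R => f z.1).
  move=> mf; apply: measurable_funTS.
  exact: measurableT_comp mf measurable_fst.
have mK : measurable_fun (setT `*` strikes) (fun z : known (info M) T * R => z.2).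
  by apply: measurable_funTS; exact: measurable_snd.
have m_put : measurable_fun (setT `*` strikes)
    (fun z : known (info M) T * R => put_dens z.1 z.2).
  apply: measurable_funM; first exact: lift.
  apply: measurable_funB.
    by apply: measurable_funM => //; exact: measurable_strike_powRV.
  apply: measurable_funM; first by apply: measurable_funM => //; exact: lift.
  apply: measurable_funM; last exact: measurable_strike_sqrV.
  by apply: measurable_ltr_natr => //; exact: lift.
have m_call : measurable_fun (setT `*` strikes)
    (fun z : known (info M) T * R => call_dens z.1 z.2).
  apply: measurable_funM.
    apply: measurable_funN; apply: measurable_funM; first exact: lift.
    by apply: measurable_funM => //; exact: lift.
  apply: measurable_funM; last exact: measurable_strike_sqrV.
  by apply: measurable_ltr_natr => //; exact: lift.
pose bonds w := c w * (Pi2 M xi p T w - E w * (1 - u w)).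
have m_bonds : measurable_fun setT (bonds : known (info M) T -> R).
  apply: measurable_funM => //; apply: measurable_funB; first exact: Pi2_known.
  apply: measurable_funM => //; apply: measurable_funB => //.
  by apply: measurable_funM => //; exact: vix_sqr_known.
(* These futures pay [c w * a * E w * (X w / F w - 1)], cancelling the linear term left by the short
   strip. *)
pose futs w := c w * (a * E w) / F w.
have m_futs : measurable_fun setT (futs : known (info M) T -> R).
  apply: measurable_funM; last by apply: measurable_inv_gt0.
  by apply: measurable_funM => //; exact: measurable_funM.
have m_spots : measurable_fun setT (cst 0 : known (info M) T -> R).
  exact: measurable_cst.
pose h := @StaticPortfolio _ _ _ _ _ _ M bonds (cst 0) futs put_dens call_dens
  m_bonds m_spots m_futs m_put m_call
  (fun w => (put_cost w).1) (fun w => (call_cost w).1)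
  (fun w => (put_pay w).1) (fun w => (call_pay w).1).
have costE w : entry_cost h w =
    c w * B * (Pi1 M xi q T w + Pi2 M xi p T w - E w).
  (* [u w * B] is the cost of [a] strips, so the proceeds of the short strip cancel the [u] term in
     the bond holding. *)
  have uE : u w = a * (
      strike_integral `]0, F w[
        (fun K => put_price M T K (T + tau) w / K ^+ 2) +
      strike_integral `]F w, +oo[
        (fun K => call_price M T K (T + tau) w / K ^+ 2)) / B.
    rewrite /u vix_sqr -/B /a /xi_tilde; field.
    by rewrite !lt0r_neq0.
  rewrite /entry_cost /= (put_cost w).2 (call_cost w).2 /bonds uE.
  rewrite /Pi1 -/a -/B -/C1 /cst; field.
  by rewrite lt0r_neq0.
have payE w : payoff h w = c w * (Pi2 M xi p T w + (X w) `^ (- (a * q)) / q -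
    E w * (1 - u w + a * (ln (F w) - ln (X w)))).
  rewrite /payoff /= (put_pay w).2 (call_pay w).2 (pow w).2.
  have [_ _ logE] := log w.
  have -> : strike_integral `]F w, +oo[ (fun K => call_payoff K (X w) / K ^+ 2) =
      ln (F w) - ln (X w) + X w / F w - 1 -
      strike_integral `]0, F w[ (fun K => put_payoff K (X w) / K ^+ 2).
    by rewrite -logE; ring.
  rewrite /bonds /futs /C1 /cst -/(X w) -/F; field.
  have /lt0r_neq0 -> := F0 w; have /lt0r_neq0 -> := q0; have /lt0r_neq0 -> := a0.
  by rewrite lt0r_neq0//; lra.
exists h; split.
- move=> w; rewrite costE /c.
  have [PE|_] := ltP _ (E w); last by rewrite mulr0n !mul0r.
  by rewrite mulr1n mul1r pmulr_rle0// subr_le0 ltW.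
- move=> w; rewrite payE mulr_ge0 ?ler0n// subr_ge0.
  apply: le_trans (young_exp _ _ _ _ _ _ (F0 w) (X0 w) p0 q0 pq) _.
  by rewrite lerD2r; exact: Pi2_ge.
(* The cost is negative where [c w] is 1 and zero elsewhere, so its negativity is exactly the event
   assumed to have positive probability. *)
left; rewrite (_ : [set w | _] =
  [set w | Pi3 M xi T w > Pi1 M xi q T w + Pi2 M xi p T w])//.
apply/seteqP; split=> w /=; rewrite costE /c Pi3E -/(u w) -/(E w).
  by case: (ltP _ (E w)) => //; rewrite mulr0n !mul0r ltxx.
by move=> PE; rewrite PE mulr1n mul1r pmulr_rlt0// subr_lt0.
Qed.
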